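(* Let $H=\prod_p p^{a_p}<H'=\prod_p p^{b_p}$ be consecutive highly composite numbers. (i) If $L_-(H,H')=0$, then the transition consists of a single insertion (i.e. $H'=Hq$ for some prime $q$) and $\beta^{\mathrm{geo}}(H,H')=1$. (ii) If $L_-(H,H')=1$, let $p$ be the unique prime with $a_p>b_p$, and write $a:=a_p=b_p+1$. Then $$\beta^{\mathrm{geo}}(H,H')=\frac{a}{a+1}\ge\frac12.$$
   Context: $d(n)$ denotes the number of positive divisors of $n$. A positive integer $H$ is highly composite if $d(m)<d(H)$ for all integers $1\le m<H$. Two highly composite numbers $H<H'$ are consecutive if no highly composite number lies strictly between them. With $H=\prod_p p^{a_p}$, $H'=\prod_p p^{b_p}$, put $L_-(H,H')=\sum_p\max(a_p-b_p,0)$. An exponent-lattice geodesic from $H$ to $H'$ is a sequence of positive integers starting at $H$ and ending at $H'$ in which each step changes the exponent of exactly one prime by one unit, always in the direction of its target exponent; increasing steps are insertions, decreasing steps are deletions. It is $H'$-admissible if every vertex $z$ satisfies $z\le H'$. The normalised geodesic capacity is $$\beta^{\mathrm{geo}}(H,H')=\frac{1}{d(H)}\max_{\gamma}\min_{z\in\gamma}d(z),$$ where $\gamma$ ranges over the $H'$-admissible geodesics from $H$ to $H'$ and $z$ over all vertices of $\gamma$, endpoints included. *)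

(* Defs.v *)
From mathcomp Require Import all_boot all_order all_algebra.
From mathcomp Require Import boolp.

Set Implicit Arguments.
Unset Strict Implicit.
Unset Printing Implicit Defensive.

Definition num_divisors (n : nat) : nat := size (divisors n).

Definition highly_composite (H : nat) : Prop :=
  0 < H /\
  forall m : nat, 1 <= m -> m < H -> num_divisors m < num_divisors H.

Definition consecutive_hc (H H' : nat) : Prop :=
  [/\ highly_composite H, highly_composite H', H < H' &
      forall K : nat, H < K -> K < H' -> ~ highly_composite K].

(* The exponent of p in n is [logn p n].  Truncated subtraction gives
   max(a_p - b_p, 0), which vanishes for p > H > 0. *)
Definition Lminus (H H' : nat) : nat :=
  \sum_(p < H.+1 | prime p) (logn p H - logn p H').

Definition insertion (H' x y p : nat) : Prop :=
  logn p y = (logn p x).+1 /\ logn p x < logn p H'.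

Definition deletion (H' x y p : nat) : Prop :=
  logn p x = (logn p y).+1 /\ logn p H' < logn p x.

Definition geo_step (H' x y : nat) : Prop :=
  exists p : nat,
    [/\ prime p,
        forall q : nat, prime q -> q != p -> logn q y = logn q x &
        insertion H' x y p \/ deletion H' x y p].

(* A sequence of vertices starting at H is encoded as [H :: s]. *)
Definition geodesic (H H' : nat) (s : seq nat) : Prop :=
  [/\ all (fun z => 0 < z) (H :: s),
      path (fun x y => `[< geo_step H' x y >]) H s &
      last H s = H'].

Definition admissible (H H' : nat) (s : seq nat) : Prop :=
  all (fun z => z <= H') (H :: s).

(* The initial value of the fold is itself attained at the vertex H. *)
Definition min_divisors (H : nat) (s : seq nat) : nat :=
  \big[minn/num_divisors H]_(z <- H :: s) num_divisors z.

(* The maximum over s of [min_divisors H s], taken over the set of attained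
   values; these are all at most [num_divisors H], since H is a vertex. *)
Definition geo_capacity (H H' : nat) : nat :=
  \max_(m < (num_divisors H).+1 |
        `[< exists s : seq nat,
              [/\ geodesic H H' s, admissible H H' s &
                  min_divisors H s = m] >]) m.

Definition beta_geo (H H' : nat) : rat :=
  ((geo_capacity H H')%:R / (num_divisors H)%:R)%R.

(* Main.v *)
(** Every [m < H'] satisfies [d(m) <= d(H)], because the least [m] with
    [d(m) > d(H)] is highly composite.  So no proper multiple of [H] lies below
    [H'].  If [H] divides [H'], this forces [H' / H] to be prime.  If the only
    deletion needed is that of one factor [p], an admissible geodesic cannot
    start with an insertion (a proper multiple of [H], different from [H']
    because of its [p]-exponent), so its first vertex is [H / p], and
    [d(H / p) = d(H) * a / (a + 1)] bounds the capacity.  Since [H / p] divides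
    [H'], inserting the remaining primes never decreases [d] afterwards. *)
Require Import Defs.
From mathcomp Require Import all_boot all_order all_algebra.
From mathcomp Require Import boolp.

Set Implicit Arguments.
Unset Strict Implicit.
Unset Printing Implicit Defensive.

(** * Divisor counts under divisibility and under removal of a prime *)

Lemma num_divisors_gt0 n : 0 < num_divisors n.
Proof.
rewrite /num_divisors; have := divisor1 n.
by case: (divisors n).
Qed.

Lemma num_divisors_le m n : 0 < n -> m %| n -> num_divisors m <= num_divisors n.
Proof.
move=> n0 mn; have m0 := dvdn_gt0 n0 mn.
apply: uniq_leq_size (divisors_uniq m) _ => d.
by rewrite -!dvdn_divisors // => /dvdn_trans; apply.
Qed.

Lemma num_divisors_lt m n :
  0 < n -> m %| n -> m < n -> num_divisors m < num_divisors n.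
Proof.
move=> n0 mn ltmn; have m0 := dvdn_gt0 n0 mn.
apply: (@uniq_leq_size _ (n :: divisors m)).
  by rewrite /= divisors_uniq andbT -dvdn_divisors // gtnNdvd.
move=> d; rewrite inE -!dvdn_divisors // => /predU1P[->//|].
by move/dvdn_trans; apply.
Qed.

(** Each divisor is [p ^ i * d] for exactly one pair with [i <= e] and [d %| m]; the exponent [i] is
    recovered as the [p]-valuation. *)
Lemma num_divisors_pfactorM p e m :
  prime p -> coprime p m -> 0 < m ->
  num_divisors (p ^ e * m) = e.+1 * num_divisors m.
Proof.
move=> pp cpm m0; have pX0 i : 0 < p ^ i by rewrite expn_gt0 prime_gt0.
have lognpX i d : d %| m -> logn p (p ^ i * d) = i.
  move=> dm; rewrite lognM // ?(dvdn_gt0 m0 dm) // pfactorK //.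
  by rewrite logn_coprime ?addn0 // (coprime_dvdr dm).
pose s := [seq p ^ i * d | i <- iota 0 e.+1, d <- divisors m].
have -> : e.+1 * num_divisors m = size s by rewrite size_allpairs size_iota.
apply/perm_size/uniq_perm; first exact: divisors_uniq.
  apply: allpairs_uniq; rewrite ?iota_uniq ?divisors_uniq //.
  move=> _ _ /allpairsP[[i d] [_ dm ->]] /allpairsP[[j d'] [_ dm' ->]] /=.
  move: dm dm'; rewrite -!dvdn_divisors //= => dm dm' eqd.
  have eij : i = j by rewrite -(lognpX i d) // eqd lognpX.
  by move/eqP: eqd; rewrite eij eqn_pmul2l // => /eqP->.
move=> d; rewrite -dvdn_divisors ?muln_gt0 ?pX0 //.
apply/idP/allpairsP => [dn | [[i d'] [ile dm ->]]]; last first.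
  move: ile dm; rewrite mem_iota -dvdn_divisors //= => ile dm.
  by rewrite dvdn_mul // dvdn_exp2l.
have d0 : 0 < d by rewrite (dvdn_gt0 _ dn) // muln_gt0 pX0.
(* The pair is the [p]-valuation of [d] and its [p]-free part, which divides [m] because it is
   coprime to [p ^ e]. *)
exists (logn p d, d`_p^'); rewrite mem_iota -dvdn_divisors //=; split.
- by rewrite ltnS -(lognpX e m) // dvdn_leq_log // muln_gt0 pX0.
- have cop : coprime d`_p^' (p ^ e).
    rewrite coprime_sym coprimeXl // prime_coprime //; apply/negP => pd.
    have : p \in p^' by apply: (pnatPpi (part_pnat _ d)); rewrite mem_primes pp part_gt0.
    by rewrite !inE eqxx.
  by rewrite -(Gauss_dvdr m cop) (dvdn_trans (dvdn_part _ _)).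
- by rewrite -p_part partnC.
Qed.

(** For [n = p ^ e.+1 * m] both sides are [e.+1 * e.+2 * num_divisors m]; the product form avoids
    fractions in [nat]. *)
Lemma num_divisors_divp p n :
  prime p -> 0 < n -> p %| n ->
  num_divisors (n %/ p) * (logn p n).+1 = num_divisors n * logn p n.
Proof.
move=> pp n0 pn; have [m cpm def_n] := pfactor_coprime pp n0.
have m0 : 0 < m by move: n0; rewrite def_n muln_gt0 => /andP[].
have : 0 < logn p n by rewrite logn_gt0 mem_primes pp n0.
move: def_n; case: (logn p n) => // e -> _.
have -> : m * p ^ e.+1 %/ p = p ^ e * m by rewrite expnS mulnCA mulKn ?prime_gt0 // mulnC.
by rewrite [m * _]mulnC !num_divisors_pfactorM // mulnAC [RHS]mulnAC [e.+2 * _]mulnC.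
Qed.

Lemma dvdn_logn m n :
  0 < m -> 0 < n -> (forall p, prime p -> logn p m <= logn p n) -> m %| n.
Proof.
move=> m0 n0 le_mn; apply/dvdn_partP => // p; rewrite mem_primes.
by case/andP=> pp _; rewrite p_part pfactor_dvdn // le_mn.
Qed.

(** * The gap between consecutive highly composite numbers *)

Lemma num_divisors_below H H' m :
  consecutive_hc H H' -> 0 < m -> m < H' -> num_divisors m <= num_divisors H.
Proof.
case=> -[H0 hcH] _ ltHH' noHC m0 ltmH'; rewrite leqNgt; apply/negP.
elim/ltn_ind: m m0 ltmH' => m IHm m0 ltmH' ltd.
have ltHm : H < m.
  rewrite ltnNge leq_eqVlt; apply/negP => /predU1P[eqmH|ltmH].
    by rewrite eqmH ltnn in ltd.
  by have := ltn_trans ltd (hcH _ m0 ltmH); rewrite ltnn.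
(* By induction every [n < m] has at most [num_divisors H] divisors, fewer than [m], so [m] would be
   highly composite strictly inside the gap. *)
apply: (noHC m) => //; split=> // n n0 ltnm.
apply: leq_ltn_trans ltd; rewrite leqNgt; apply/negP.
exact: IHm (ltn_trans ltnm ltmH').
Qed.

Lemma dvdn_next_hc H H' m :
  consecutive_hc H H' -> H %| m -> H < m -> m <= H' -> m = H'.
Proof.
move=> cons Hm ltHm; have m0 := leq_ltn_trans (leq0n H) ltHm.
rewrite leq_eqVlt => /predU1P[// | ltmH'].
have := num_divisors_below cons m0 ltmH'.
by rewrite leqNgt num_divisors_lt.
Qed.

(** * Geodesics made of insertions, and evaluation of the capacity *)

Lemma logn_nonprime p n : ~~ prime p -> logn p n = 0.
Proof. by move=> npp; rewrite lognE (negPf npp). Qed.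

Lemma logn_mul_prime p q n :
  prime p -> 0 < n -> logn q (n * p) = (q == p) + logn q n.
Proof. by move=> pp n0; rewrite lognM ?(prime_gt0 pp) // (logn_prime q pp) addnC. Qed.

Lemma geo_step_mul H' x p :
  0 < H' -> prime p -> x * p %| H' -> geo_step H' x (x * p).
Proof.
move=> H'0 pp xpH'; have := dvdn_gt0 H'0 xpH'; rewrite muln_gt0 => /andP[x0 _].
have logp : logn p (x * p) = (logn p x).+1 by rewrite logn_mul_prime // eqxx.
exists p; split=> // [q _ neq|]; first by rewrite logn_mul_prime // (negPf neq).
by left; split; rewrite // -logp dvdn_leq_log.
Qed.

(** Induction on the cofactor [k], inserting its least prime factor first. The invariant
    [G %| z %| H'] serves twice: it bounds [num_divisors z] from below and gives [z <= H']. *)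
Lemma insertion_path G H' :
  0 < H' -> G %| H' ->
  exists s, [/\ path (fun x y => `[< geo_step H' x y >]) G s, last G s = H' &
                {in s, forall z, (G %| z) && (z %| H')}].
Proof.
move=> H'0 /dvdnP[k]; elim/ltn_ind: k G => k IHk G defH'.
have k0 : 0 < k by move: H'0; rewrite defH' muln_gt0 => /andP[].
have [k1|k_gt1] := leqP k 1.
  by exists [::]; split=> //=; rewrite defH' (_ : k = 1) ?mul1n //; apply/eqP; rewrite eqn_leq k1.
set p := pdiv k; have pp : prime p by apply: pdiv_prime.
have ltkp : k %/ p < k by rewrite ltn_Pdiv ?prime_gt1.
have defk : H' = k %/ p * (G * p).
  by rewrite [G * p]mulnC mulnA divnK ?pdiv_dvd.
have [s [paths lasts ins]] := IHk _ ltkp _ defk.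
have GpH' : G * p %| H' by rewrite defk dvdn_mull.
exists (G * p :: s); split=> //=.
  by rewrite paths andbT; apply/asboolP/geo_step_mul.
move=> z; rewrite inE => /predU1P[->|/ins/andP[Gpz ->]].
  by rewrite dvdn_mulr.
by rewrite andbT (dvdn_trans _ Gpz) // dvdn_mulr.
Qed.

Lemma min_divisors_le H s z : z \in H :: s -> min_divisors H s <= num_divisors z.
Proof.
rewrite /min_divisors; move: (H :: s) => t.
elim: t => // x t IHt; rewrite inE big_cons geq_min.
by case/predU1P=> [->|/IHt->]; rewrite ?leqnn ?orbT.
Qed.

Lemma min_divisors_ge H s m :
  {in H :: s, forall z, m <= num_divisors z} -> m <= min_divisors H s.
Proof.
move=> lem; rewrite /min_divisors big_seq.
elim/big_ind: _ => [|x y mx my|z]; [|by rewrite leq_min mx|exact: lem].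
(* The initial value of the fold is harmless, since [H] is a vertex. *)
by apply: lem; rewrite mem_head.
Qed.

Lemma geo_capacity_eq H H' m :
  (exists s, [/\ geodesic H H' s, admissible H H' s &
                 {in H :: s, forall z, m <= num_divisors z}]) ->
  (forall s, geodesic H H' s -> admissible H H' s ->
     exists2 z, z \in H :: s & num_divisors z <= m) ->
  geo_capacity H H' = m.
Proof.
move=> [s [geos adms ges]] le_m; apply/eqP; rewrite eqn_leq; apply/andP; split.
  apply/bigmax_leqP => i /asboolP[t [geot admt <-]].
  have [z zt] := le_m t geot admt.
  exact: leq_trans (min_divisors_le zt).
(* The minimum must lie in the index range of the maximum; the vertex [H] ensures this. *)
have lt_min : min_divisors H s < (num_divisors H).+1.
  by rewrite ltnS min_divisors_le // mem_head.
apply: leq_trans (min_divisors_ge ges) _.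
apply: (@leq_bigmax_cond _ _ (fun i : 'I__ => nat_of_ord i) (Ordinal lt_min)).
by apply/asboolP; exists s.
Qed.

(** * Exponent comparison from the value of [Lminus] *)

Lemma Lminus_eq0 H H' :
  0 < H -> Lminus H H' = 0 -> forall p, prime p -> logn p H <= logn p H'.
Proof.
move=> H0 /eqP; rewrite sum_nat_eq0 => /forallP L0 p pp.
have [ltpH|leHp] := ltnP p H.+1.
  by have /implyP/(_ pp) := L0 (Ordinal ltpH); rewrite subn_eq0.
(* Primes above [H] lie outside the sum, but do not divide [H]. *)
by rewrite lognE gtnNdvd // !andbF.
Qed.

Lemma Lminus_eq1 H H' :
  0 < H -> Lminus H H' = 1 ->
  exists p, [/\ prime p, logn p H = (logn p H').+1 &
    forall q, prime q -> q != p -> logn q H <= logn q H'].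
Proof.
move=> H0 /eqP/sum_nat_eq1[p [pp Lp Lq]].
exists p; split=> // [|q pq neq].
  have ltp : logn p H' < logn p H by rewrite -subn_gt0 Lp.
  by rewrite -[LHS](subnK (ltnW ltp)) Lp.
have [ltqH|leHq] := ltnP q H.+1.
  by apply/eqP; have := Lq (Ordinal ltqH) neq pq.
by rewrite lognE gtnNdvd // !andbF.
Qed.

(** * The pure insertion case and the single deletion case *)

Lemma dvdn_consecutive_hc H H' :
  consecutive_hc H H' -> H %| H' -> exists2 q, prime q & H' = H * q.
Proof.
move=> cons; have [[H0 _] [H'0 _] ltHH' _] := cons.
case/dvdnP=> k defH'; set q := pdiv k.
have k_gt1 : 1 < k by rewrite -(ltn_pmul2r H0) mul1n -defH'.
have pq : prime q by apply: pdiv_prime.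
exists q => //; symmetry; apply: (dvdn_next_hc cons).
- by rewrite dvdn_mulr.
- by rewrite -[ltnLHS]muln1 ltn_pmul2l ?prime_gt1.
- by rewrite defH' mulnC leq_pmul2r // pdiv_leq // ltnW.
Qed.

Lemma geo_capacity_insertion H H' :
  consecutive_hc H H' -> H %| H' -> geo_capacity H H' = num_divisors H.
Proof.
move=> [[H0 _] [H'0 _] ltHH' _] HH'.
apply: geo_capacity_eq => [|s _ _]; last by exists H; rewrite ?mem_head.
have [s [paths lasts ins]] := insertion_path H'0 HH'.
have inHs z : z \in H :: s -> (H %| z) && (z %| H').
  by rewrite inE => /predU1P[->|/ins//]; rewrite dvdnn.
have z0 z : z \in H :: s -> 0 < z.
  by case/inHs/andP=> _; apply: dvdn_gt0.
exists s; split.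
- by split=> //; apply/allP.
- by apply/allP => z /inHs/andP[_]; apply: dvdn_leq.
- by move=> z zs; apply: num_divisors_le (z0 _ zs) _; case/andP: (inHs _ zs).
Qed.

Lemma geo_capacity_deletion H H' p :
  consecutive_hc H H' -> prime p -> logn p H = (logn p H').+1 ->
  (forall q, prime q -> q != p -> logn q H <= logn q H') ->
  geo_capacity H H' = num_divisors (H %/ p).
Proof.
move=> cons pp logp leq_logq; have [[H0 _] [H'0 _] ltHH' _] := cons.
have pH : p %| H.
  have : 0 < logn p H by rewrite logp.
  by rewrite logn_gt0 mem_primes => /and3P[].
set G := H %/ p; have defH : H = G * p by rewrite divnK.
have G0 : 0 < G by move: H0; rewrite defH muln_gt0 => /andP[].
have lognG q : logn q H = (q == p) + logn q G by rewrite defH logn_mul_prime.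
have GH : G %| H by rewrite defH dvdn_mulr.
have ltGH : G < H by rewrite ltn_Pdiv ?prime_gt1.
have logpG : logn p G = logn p H'.
  by move: (lognG p); rewrite logp eqxx => -[].
have GH' : G %| H'.
  apply: dvdn_logn => // q pq; have [->|neq] := eqVneq q p; first by rewrite logpG.
  by have := leq_logq q pq neq; rewrite lognG (negPf neq).
apply: geo_capacity_eq.
  have [s [paths lasts ins]] := insertion_path H'0 GH'.
  have inGs z : z \in G :: s -> (G %| z) && (z %| H').
    by rewrite inE => /predU1P[->|/ins//]; rewrite dvdnn.
  have z0 z : z \in G :: s -> 0 < z.
    by case/inGs/andP=> _; apply: dvdn_gt0.
  (* Optimal geodesic: delete [p] at once, then only insert; every later vertex is a multiple of
     [G]. *)
  exists (G :: s); split.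
  - split=> //; first by apply/allP => z; rewrite inE => /predU1P[->|/z0].
    rewrite /= paths andbT; apply/asboolP; exists p; split=> // [q pq neq|].
      by rewrite lognG (negPf neq).
    by right; split; rewrite logp ?logpG.
  - apply/allP => z; rewrite inE => /predU1P[->|/inGs/andP[_]]; first exact: ltnW.
    exact: dvdn_leq.
  - move=> z; rewrite inE => /predU1P[->|zs]; first exact: num_divisors_le.
    by apply: num_divisors_le (z0 _ zs) _; case/andP: (inGs _ zs).
case=> [[_ _ /= eqHH']|y s [/= /and3P[_ y0 _] /andP[/asboolP step _] _]].
  by rewrite eqHH' ltnn in ltHH'.
case/and3P=> _ leyH' _; exists y; first by rewrite inE mem_head orbT.
(* For the upper bound, the first vertex [y] after [H] suffices. If it inserts [q], then [y = H * q]
   is forced to equal [H'], contradicting the drop in the exponent of [p]. *)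
case: step => q [pq logy [[insq _]|[delq ltq]]].
  have defy : y = H * q.
    apply: eqn_from_log => // [|r]; first by rewrite muln_gt0 H0 prime_gt0.
    rewrite logn_mul_prime //; have [->//|neq] := eqVneq r q.
    have [pr|npr] := boolP (prime r); first by rewrite logy.
    by rewrite !logn_nonprime.
  have eqyH' : y = H'.
    apply: (dvdn_next_hc cons) => //; rewrite defy ?dvdn_mulr //.
    by rewrite -[ltnLHS]muln1 ltn_pmul2l ?prime_gt1.
  have : logn p H <= logn p H' by rewrite -eqyH' defy logn_mul_prime // leq_addl.
  by rewrite logp ltnn.
(* A first deletion must remove [p], the only prime whose exponent exceeds its target, so
   [y = G]. *)
have eqqp : q = p.
  by apply/eqP; apply: contraLR ltq => neq; rewrite -leqNgt leq_logq.
subst q; rewrite (_ : y = G) //.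
apply: eqn_from_log => // r; have [->|neq] := eqVneq r p.
  by rewrite logpG; move: delq; rewrite logp => -[].
have [pr|npr] := boolP (prime r); first by rewrite logy // lognG (negPf neq).
by rewrite !logn_nonprime.
Qed.

Theorem theorem5p1 (H H' : nat) (hHH' : consecutive_hc H H') :
  (Lminus H H' = 0 ->
     (exists q : nat, prime q /\ H' = H * q) /\ beta_geo H H' = 1%R)
  /\
  (Lminus H H' = 1 ->
     (exists! p : nat, prime p /\ logn p H' < logn p H)
     /\
     forall p a : nat, prime p -> logn p H' < logn p H -> a = logn p H ->
       [/\ a = logn p H' + 1,
           beta_geo H H' = (a%:R / (a + 1)%:R)%R &
           (1 / 2 <= (a%:R / (a + 1)%:R : rat))%R]).
Proof.
have [[H0 _] [H'0 _] _ _] := hHH'.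
have dH_neq0 : ((num_divisors H)%:R != 0 :> rat)%R.
  by rewrite Num.Theory.pnatr_eq0 -lt0n num_divisors_gt0.
split=> [L0 | L1].
  have HH' : H %| H' by apply: dvdn_logn => //; apply: Lminus_eq0.
  have [q pq defH'] := dvdn_consecutive_hc hHH' HH'.
  split; first by exists q.
  by rewrite /beta_geo geo_capacity_insertion // GRing.divff.
have [p [pp logp leq_logq]] := Lminus_eq1 H0 L1.
have uniq_p q : prime q -> logn q H' < logn q H -> p = q.
  move=> pq; rewrite ltnNge => ltq; apply/eqP; rewrite eq_sym.
  by apply: contraNT ltq => /leq_logq->.
split; first by exists p; split=> [|q [pq ltq]]; [rewrite logp | apply: uniq_p].
move=> q a pq ltq defa; rewrite -{q pq ltq}(uniq_p q pq ltq) in defa *.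
have a0 : 0 < a by rewrite defa logp.
have a1_neq0 : ((a + 1)%:R != 0 :> rat)%R by rewrite Num.Theory.pnatr_eq0 addn1.
split; first by rewrite defa logp addn1.
  have pH : p %| H by move: a0; rewrite defa logn_gt0 mem_primes => /and3P[].
  apply/eqP; rewrite /beta_geo (geo_capacity_deletion hHH' pp logp leq_logq).
  (* Cross-multiplication turns the claim into [num_divisors_divp]. *)
  rewrite GRing.eqr_div // -!GRing.natrM Num.Theory.eqr_nat addn1 defa.
  by rewrite num_divisors_divp // mulnC.
rewrite Num.Theory.ler_pdivlMr ?Num.Theory.ltr0n ?addn1 //.
rewrite GRing.mul1r GRing.mulrC Num.Theory.ler_pdivrMr ?Num.Theory.ltr0n //.
(* What remains is [a + 1 <= 2 * a], that is, [0 < a]. *)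
by rewrite -GRing.natrM Num.Theory.ler_nat muln2 -addnn -[ltnLHS]add0n ltn_add2r.
Qed.
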